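(* Let $X$ be a real or complex Banach space. Let $(x_i)\in\ell^{1}(X)$ with $\|(x_i)\|=1$, and $\|x_i\|\neq 0$ for all $i\in\mathbb{N}$. Then $S_{(x_i)}$ is norm compact in $\ell^\infty(X^* )$ if and only if $S_{\frac{x_i}{\|x_i\|}}$ is norm compact in $X^*$ for each $i\in\mathbb{N}$ and $\operatorname{diam}\left(S_{\frac{x_i}{\|x_i\|}}\right)\to 0$ as $i\to\infty$.
   Context: $\ell^1(X)$ is the Banach space of sequences $(x_i)_{i\in\mathbb{N}}$ in $X$ with $\|(x_i)\|=\sum_{i}\|x_i\|<\infty$. Its dual is identified with $\ell^\infty(X^* )$, the space of bounded sequences $(x_i^* )_{i\in\mathbb{N}}$ in $X^*$ with the supremum norm, via $(x_i^* )((x_i))=\sum_i x_i^*(x_i)$. For a Banach space $E$ with unit sphere $S(E)$ and $e\in S(E)$, the state space of $e$ is $S_e=\{e^*\in S(E^* ):e^*(e)=1\}\subseteq E^*$; $S_{(x_i)}$ is taken with $E=\ell^1(X)$ and $S_{x_i/\|x_i\|}$ with $E=X$. Norm compact means compact in the norm topology. $\operatorname{diam}$ is the diameter with respect to the norm of $X^*$. *)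

(* Defs.v *)
From HB Require Import structures.
From mathcomp Require Import all_boot all_order all_algebra.
From mathcomp Require Import all_classical all_reals all_analysis.
From mathcomp Require Import complex.

Set Implicit Arguments.
Unset Strict Implicit.
Unset Printing Implicit Defensive.

Import Order.TTheory GRing.Theory Num.Theory.
Import numFieldNormedType.Exports.

Local Open Scope classical_set_scope.
Local Open Scope ring_scope.

(* A real (resp. complex) Banach space is a completeNormedModType over
   scalars R RealScalars, i.e. R (resp. scalars R ComplexScalars, i.e. R[i]). *)
Inductive scalar_kind := RealScalars | ComplexScalars.

Definition scalars (R : realType) (k : scalar_kind) : numFieldType :=
  match k with RealScalars => R | ComplexScalars => R[i] end.

Section scalars_theory.
Variables (R : realType) (k : scalar_kind).
Local Notation K := (scalars R k).

(* In R[i] the order is x <= y iff y - x is a nonnegative real number, so that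
   norms and suprema of sets of norms may be taken in K in both cases. *)
Lemma scalars_supremums (A : set K) : A !=set0 -> (forall a, A a -> 0 <= a) ->
  ubound A !=set0 -> supremums A !=set0.
Proof.
case: k A => A [a0 Aa0] Age0 [M AM].
  have hs : has_sup (A : set R) by split; [exists a0|exists M].
  exists (sup (A : set R)); split; first exact: sup_upper_bound.
  by move=> y Ay; apply: (@ge_sup R A y) => //; exists a0.
pose B := [set complex.Re a | a in (A : set R[i])].
have AE (a : R[i]) : A a -> a = ((complex.Re a)%:C)%C.
  by move=> /Age0 /ger0_real /RRe_real.
have hs : has_sup B.
  split; first by exists (complex.Re (a0 : R[i])), a0.
  exists (complex.Re (M : R[i])) => _ [a Aa <-].
  by have /= := AM _ Aa; rewrite lecE => /andP[].
exists (((sup B)%:C)%C : R[i]); split.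
  move=> a Aa; rewrite [X in X <= _](AE _ Aa) lecR.
  by apply: sup_upper_bound => //; exists a.
move=> y Ay; have := Ay _ Aa0; rewrite [X in X <= _ -> _](AE _ Aa0) /= !lecE /=.
move=> /andP[-> _] /=; apply: ge_sup; first by case: hs.
by move=> _ [a Aa <-]; have := Ay _ Aa; rewrite lecE => /andP[].
Qed.

Lemma scalars_ndcvg (u : nat -> K) (M : K) : 0 <= u 0%N ->
  {homo u : m n / (m <= n)%N >-> m <= n} -> (forall n, u n <= M) ->
  exists2 l : K, u @ \oo --> l & (forall n, u n <= l) /\
    (forall y, (forall n, u n <= y) -> l <= y).
Proof.
move=> u0 und uM.
have uge0 n : 0 <= u n by rewrite (le_trans u0)// und.
have [|||l [lub llub]] := @scalars_supremums (range u).
- by exists (u 0%N), 0%N.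
- by move=> _ [n _ <-].
- by exists M => _ [n _ <-].
have ul n : u n <= l by apply: lub; exists n.
exists l; last by split=> // y uy; apply: llub => _ [n _ <-].
apply/cvgrPdist_lt => e e0.
have lreal : l \is Num.real by rewrite ger0_real// (le_trans u0).
have [n un] : exists n, l - e < u n.
  apply/not_existsP => H.
  have : l <= l - e.
    apply: llub => _ [n _ <-].
    have /negP := H n; rewrite -real_leNgt//.
      by rewrite ger0_real.
    by rewrite realB// gtr0_real.
  by rewrite -subr_ge0 addrAC subrr sub0r oppr_ge0 => /(lt_le_trans e0); rewrite ltxx.
near=> m; rewrite ger0_norm ?subr_ge0//.
rewrite ltrBlDr -ltrBlDl (lt_le_trans un)// und//.
by near: m; exists n.
Unshelve. all: by end_near. Qed.



Section summable.
Variable V : normedModType K.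
Implicit Types u v : nat -> V.

Definition abs_summable u := cvgn (series (fun i => `|u i|) : nat -> K).

Definition sum_norm u : K := limn (series (fun i => `|u i|) : nat -> K).

Let S u n : K := \sum_(i < n) `|u i|.

Let S_nd u m n : (m <= n)%N -> S u m <= S u n.
Proof.
move=> mn; rewrite /S -!(big_mkord xpredT (fun i => `|u i|)).
by rewrite [leRHS](big_cat_nat (n := m))//= lerDl sumr_ge0.
Qed.

Let S_series u : series (fun i => `|u i|) = S u :> (nat -> K).
Proof. by apply/funext => n; rewrite /series/= big_mkord. Qed.

Lemma abs_summable_bounded u (M : K) :
  (forall n, \sum_(i < n) `|u i| <= M) -> abs_summable u.
Proof.
move=> uM; rewrite /abs_summable S_series.
have [||] := @scalars_ndcvg (S u) M _ _ uM.
- by rewrite /S big_ord0.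
- by move=> m n; exact: S_nd.
- by move=> l ul _; apply/cvg_ex; exists l.
Qed.

Lemma sum_norm_sup u : abs_summable u ->
  (forall n, \sum_(i < n) `|u i| <= sum_norm u) /\
  (forall y, (forall n, \sum_(i < n) `|u i| <= y) -> sum_norm u <= y).
Proof.
rewrite /abs_summable /sum_norm S_series => cu.
have [M uM] : exists M : K, forall n, S u n <= M.
  have [M [Mreal /(_ (M + 1))]] := cvg_seq_bounded cu.
  rewrite ltrDl ltr01 => /(_ isT) uM; exists (M + 1) => n.
  have := uM n I; apply: le_trans.
  by rewrite ger0_norm// /S sumr_ge0.
have [||l ul lP] := @scalars_ndcvg (S u) M _ _ uM.
- by rewrite /S big_ord0.
- by move=> m n; exact: S_nd.
by rewrite (cvg_lim _ ul).
Qed.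

Lemma sum_norm_ge0 u : abs_summable u -> 0 <= sum_norm u.
Proof. by move=> /sum_norm_sup[/(_ 0%N) + _]; rewrite big_ord0. Qed.

Lemma le_sum_norm u i : abs_summable u -> `|u i| <= sum_norm u.
Proof.
move=> /sum_norm_sup[/(_ i.+1) + _]; apply: le_trans.
by rewrite big_ord_recr/= lerDr sumr_ge0.
Qed.

Lemma le_sum_normD u v n : abs_summable u -> abs_summable v ->
  \sum_(i < n) `|(u + v) i| <= sum_norm u + sum_norm v.
Proof.
move=> su sv; have [Su _] := sum_norm_sup su; have [Sv _] := sum_norm_sup sv.
rewrite (le_trans _ (lerD (Su n) (Sv n)))// -big_split/=.
by apply: ler_sum => i _; exact: ler_normD.
Qed.

Lemma le_sum_normZ a u n : abs_summable u ->
  \sum_(i < n) `|(a *: u) i| <= `|a| * sum_norm u.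
Proof.
move=> su; have [Su _] := sum_norm_sup su.
rewrite (le_trans _ (ler_wpM2l (normr_ge0 a) (Su n)))// mulr_sumr.
by apply: ler_sum => i _; rewrite -normrZ.
Qed.

End summable.

Lemma real_abs_summable_cvg (u : nat -> K^o) : (forall i, u i \is Num.real) ->
  abs_summable u -> cvgn (series u).
Proof.
move=> ur su; have [Su _] := sum_norm_sup su.
pose v i : K^o := `|u i| + u i.
have v0 i : 0 <= v i.
  by rewrite /v -lerBlDr sub0r -normrN real_ler_norm ?realN.
have sv : abs_summable v.
  apply: (@abs_summable_bounded _ v (sum_norm u + sum_norm u)) => n.
  rewrite (le_trans _ (lerD (Su n) (Su n)))// -big_split/=.
  apply: ler_sum => i _; rewrite (le_trans (ler_normD _ _))// normr_id.
  exact: lexx.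
have -> : u = v \- (fun i => `|u i| : K^o).
  by apply/funext => i; rewrite /v/= addrAC subrr add0r.
have -> : series (v \- (fun i => `|u i| : K^o)) =
    series v \- series (fun i => `|u i| : K^o).
  by apply/funext => n; rewrite /series/= sumrB.
apply: is_cvgB => //.
suff -> : v = (fun i => `|v i|) by exact: sv.
by apply/funext => i; rewrite ger0_norm.
Qed.

Section supnorm.
Variables (T : Type) (V : normedModType K).
Implicit Types (D : set T) (u v : T -> V).

Definition supnorm D u : K := supremum 0 [set `|u t| | t in D].

Lemma supnorm_le D u M : 0 <= M -> (forall t, D t -> `|u t| <= M) ->
  supnorm D u <= M.
Proof.
move=> M0 uM; rewrite /supnorm /supremum; case: ifPn => // /set0P A0.
case: xgetP => [l _ [_]|//]; apply=> _ [t Dt <-]; exact: uM.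
Qed.

Lemma le_supnorm D u M t : (forall t, D t -> `|u t| <= M) -> D t ->
  `|u t| <= supnorm D u.
Proof.
move=> uM Dt; have At : [set `|u t| | t in D] `|u t| by exists t.
have [||l lP] := @scalars_supremums _ (ex_intro _ _ At).
- by move=> _ [s _ <-].
- by exists M => _ [s Ds <-]; exact: uM.
rewrite /supnorm /supremum ifF; last by apply/negbTE/set0P; exists `|u t|.
by case: xgetP => [m _ [+ _]|/(_ _ lP)//]; apply.
Qed.

Lemma supnorm_ge0 D u : 0 <= supnorm D u.
Proof.
rewrite /supnorm /supremum; case: ifPn => // /set0P[_ [t Dt _]].
case: xgetP => [l _ [lu _]|//]; apply: (le_trans (normr_ge0 (u t))).
by apply: lu; exists t.
Qed.

Lemma supnormD D u v M N : (forall t, D t -> `|u t| <= M) ->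
  (forall t, D t -> `|v t| <= N) ->
  supnorm D (u + v) <= supnorm D u + supnorm D v.
Proof.
move=> uM vN; apply: supnorm_le => [|t Dt]; first by rewrite addr_ge0 ?supnorm_ge0.
rewrite (le_trans (ler_normD _ _))// lerD//.
- exact: le_supnorm uM Dt.
- exact: le_supnorm vN Dt.
Qed.

Lemma supnormZ D a u M : (forall t, D t -> `|u t| <= M) ->
  supnorm D (a *: u) = `|a| * supnorm D u.
Proof.
move=> uM; apply/eqP; rewrite eq_le; apply/andP; split.
  apply: supnorm_le => [|t Dt]; first by rewrite mulr_ge0 ?supnorm_ge0.
  by rewrite normrZ ler_wpM2l//; exact: le_supnorm uM Dt.
have [->|a0] := eqVneq a 0; first by rewrite normr0 mul0r supnorm_ge0.
rewrite -ler_pdivlMl ?normr_gt0//; apply: supnorm_le => [|t Dt].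
  by rewrite mulr_ge0 ?invr_ge0 ?supnorm_ge0.
rewrite ler_pdivlMl ?normr_gt0// -normrZ.
apply: (@le_supnorm D (a *: u) (`|a| * M)) => // s Ds.
by rewrite normrZ ler_wpM2l// uM.
Qed.

End supnorm.

End scalars_theory.

Lemma is_cvg_seriesDZ (F : numFieldType) (u v w : nat -> F^o) (a : F) :
  (forall i, w i = u i + a * v i) -> cvgn (series u) -> cvgn (series v) ->
  cvgn (series w).
Proof.
move=> wE cu cv; have -> : series w = series u \+ a \*: series v.
  apply/funext => n; rewrite /series/= scaler_sumr -big_split/=.
  by apply: eq_bigr => i _; rewrite wE.
by apply: is_cvgD => //; exact: is_cvgZl_tmp.
Qed.

Lemma abs_summable_cvg (R : realType) (k : scalar_kind)
    (u : nat -> (scalars R k)^o) : abs_summable u -> cvgn (series u).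
Proof.
case: k u => u su.
  by apply: (@real_abs_summable_cvg R RealScalars) => // i; exact: num_real.
have [Su _] := sum_norm_sup su.
pose re i : (scalars R ComplexScalars)^o := ((complex.Re (u i))%:C)%C.
pose im i : (scalars R ComplexScalars)^o := ((complex.Im (u i))%:C)%C.
have reu i : `|re i| <= `|u i|.
  rewrite !normc_def lecR/= expr0n addr0 ler_sqrt ?lerDl ?sqr_ge0//.
  by rewrite addr_ge0 ?sqr_ge0.
have imu i : `|im i| <= `|u i|.
  rewrite !normc_def lecR/= expr0n addr0 ler_sqrt ?lerDr ?sqr_ge0//.
  by rewrite addr_ge0 ?sqr_ge0.
have cre : cvgn (series re).
  apply: real_abs_summable_cvg; first by move=> i; rewrite complex_real.
  apply: (@abs_summable_bounded _ _ _ re (sum_norm u)) => n.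
  by rewrite (le_trans _ (Su n))//; apply: ler_sum => i _; exact: reu.
have cim : cvgn (series im).
  apply: real_abs_summable_cvg; first by move=> i; rewrite complex_real.
  apply: (@abs_summable_bounded _ _ _ im (sum_norm u)) => n.
  by rewrite (le_trans _ (Su n))//; apply: ler_sum => i _; exact: imu.
apply: (@is_cvg_seriesDZ (scalars R ComplexScalars) re im u 'i%C _ cre cim) => i.
exact: complexE.
Qed.

Lemma lim_series_le_sum_norm (R : realType) (k : scalar_kind)
    (u : nat -> (scalars R k)^o) : abs_summable u ->
  `|limn (series u)| <= sum_norm u.
Proof.
move=> su; have cu := abs_summable_cvg su.
have sM n : `|series u n| <= sum_norm u.
  have [Su _] := sum_norm_sup su.
  by rewrite /series/= big_mkord (le_trans (ler_norm_sum _ _ _)).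
have lu : `|series u n| @[n --> \oo] --> `|limn (series u)|.
  exact: cvg_norm.
rewrite real_leNgt ?normr_real ?ger0_real ?sum_norm_ge0//; apply/negP => lt.
have /cvgrPdist_lt /(_ (`|limn (series u)| - sum_norm u)) := lu.
rewrite subr_gt0 => /(_ lt) [n _ /(_ n (leqnn n))] /=.
have sl : `|series u n| <= `|limn (series u)| by rewrite (le_trans (sM n))// ltW.
by rewrite ger0_norm ?subr_ge0// ltrD2l ltrN2 => /(le_lt_trans (sM n)); rewrite ltxx.
Qed.


Section dual.
Variables (R : realType) (k : scalar_kind).
Local Notation K := (scalars R k).
Variable E : normedModType K.

Definition is_dual : {pred E -> K^o} :=
  [pred f | `[< linear f /\ continuous f >]].

Record dual := Dual { dual_val :> E -> K^o; dualP : dual_val \in is_dual }.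

HB.instance Definition _ := [isSub for dual_val].
HB.instance Definition _ := [Choice of dual by <:].

Lemma dual_linear (f : dual) : linear f.
Proof. by have /asboolP[] := dualP f. Qed.

HB.instance Definition _ (f : dual) :=
  GRing.isLinear.Build K E K^o *:%R f (@dual_linear f).

Lemma dual_continuous (f : dual) : continuous f.
Proof. by have /asboolP[] := dualP f. Qed.

Lemma is_dual_submod_closed : submod_closed is_dual.
Proof.
split.
  apply/asboolP; split=> [a x y|x]; first by rewrite scaler0 addr0.
  exact: cvg_cst.
move=> a f g /asboolP[fl fc] /asboolP[gl gc]; apply/asboolP; split=> [b x y|x].
  rewrite -[LHS]/(a *: f (b *: x + y) + g (b *: x + y)).
  rewrite -[RHS]/(b *: (a *: f x + g x) + (a *: f y + g y)).
  rewrite fl gl !scalerDr !scalerA [b * a]mulrC -!addrA; congr (_ + _).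
  by rewrite addrCA.
by apply: cvgD; [apply: cvgZl_tmp; exact: fc|exact: gc].
Qed.

HB.instance Definition _ :=
  GRing.isSubmodClosed.Build K (E -> K^o) is_dual is_dual_submod_closed.
HB.instance Definition _ := [SubChoice_isSubLmodule of dual by <:].

Let ball1 : set E := [set x | `|x| <= 1].

Definition dual_norm (f : dual) : K := supnorm ball1 f.

Lemma dual_bounded (f : dual) :
  exists2 M : K, 0 <= M & forall x, `|f x| <= M * `|x|.
Proof.
have /linear_bounded_continuous/linear_boundedP := @dual_continuous f.
by move=> /pinfty_ex_gt0[M M0 fM]; exists M => //; exact: ltW.
Qed.

Let dual_ball1 (f : dual) : exists M, forall x, ball1 x -> `|f x| <= M.
Proof.
have [M M0 fM] := dual_bounded f; exists M => x x1.
by rewrite (le_trans (fM x))// -[leRHS]mulr1 ler_wpM2l.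
Qed.

Let dual_normD (f g : dual) : dual_norm (f + g) <= dual_norm f + dual_norm g.
Proof.
by have [M fM] := dual_ball1 f; have [N gN] := dual_ball1 g; exact: supnormD fM gN.
Qed.

Let dual_normZ (a : K) (f : dual) : dual_norm (a *: f) = `|a| * dual_norm f.
Proof. by have [M fM] := dual_ball1 f; exact: supnormZ fM. Qed.

Let dual_norm_eq0 (f : dual) : dual_norm f = 0 -> f = 0.
Proof.
move=> f0; apply/val_inj/funext => x; rewrite -[RHS]/(0 : K^o).
have [M fM] := dual_ball1 f.
have [->|x0] := eqVneq x 0; first by rewrite -[LHS]/(f 0) linear0.
have : `|f (`|x|^-1 *: x)| <= 0.
  rewrite -f0; apply: le_supnorm fM _.
  by rewrite /ball1/= normrZ normfV normr_id mulVf ?normr_eq0.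
rewrite normr_le0 linearZ/= scaler_eq0 invr_eq0 normr_eq0 (negPf x0)/=.
by move/eqP.
Qed.

HB.instance Definition _ := Lmodule_isNormed.Build K dual
  dual_normD dual_normZ dual_norm_eq0.

Lemma dual_le_norm (f : dual) x : `|f x| <= `|f| * `|x|.
Proof.
have [M fM] := dual_ball1 f.
have [->|x0] := eqVneq x 0; first by rewrite linear0 normr0 mulr_ge0.
have : `|f (`|x|^-1 *: x)| <= `|f|.
  apply: le_supnorm fM _.
  by rewrite /ball1/= normrZ normfV normr_id mulVf ?normr_eq0.
by rewrite linearZ/= normrZ normfV normr_id ler_pdivrMl ?normr_gt0// mulrC.
Qed.

End dual.

Section ell1.
Variables (R : realType) (k : scalar_kind).
Local Notation K := (scalars R k).
Variable E : normedModType K.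

Definition is_ell1 : {pred nat -> E} := [pred x | `[< abs_summable x >]].

Record ell1 := Ell1 { ell1_val :> nat -> E; ell1P : ell1_val \in is_ell1 }.

HB.instance Definition _ := [isSub for ell1_val].
HB.instance Definition _ := [Choice of ell1 by <:].

Lemma ell1_summable (x : ell1) : abs_summable x.
Proof. by have /asboolP := ell1P x. Qed.

Lemma is_ell1_submod_closed : submod_closed is_ell1.
Proof.
split.
  apply/asboolP; apply: (@abs_summable_bounded _ _ _ _ 0) => n.
  by rewrite big1// => i _; rewrite normr0.
move=> a x y /asboolP xs /asboolP ys; apply/asboolP.
have axs : abs_summable (a *: x).
  by apply: abs_summable_bounded => n; exact: (le_sum_normZ a n xs).
by apply: abs_summable_bounded => n; exact: (le_sum_normD n axs ys).
Qed.

HB.instance Definition _ :=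
  GRing.isSubmodClosed.Build K (nat -> E) is_ell1 is_ell1_submod_closed.
HB.instance Definition _ := [SubChoice_isSubLmodule of ell1 by <:].

Definition ell1_norm (x : ell1) : K := sum_norm x.

Let ell1_normD (x y : ell1) : ell1_norm (x + y) <= ell1_norm x + ell1_norm y.
Proof.
have [_] := sum_norm_sup (@ell1_summable (x + y)); apply=> n.
exact: (le_sum_normD n (@ell1_summable x) (@ell1_summable y)).
Qed.

Let ell1_normZ (a : K) (x : ell1) : ell1_norm (a *: x) = `|a| * ell1_norm x.
Proof.
have le b (y : ell1) : ell1_norm (b *: y) <= `|b| * ell1_norm y.
  have [_] := sum_norm_sup (@ell1_summable (b *: y)); apply=> n.
  exact: (le_sum_normZ b n (@ell1_summable y)).
apply/eqP; rewrite eq_le le/=.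
have [->|a0] := eqVneq a 0.
  by rewrite normr0 mul0r sum_norm_ge0//; exact: ell1_summable.
rewrite -ler_pdivlMl ?normr_gt0// -normfV (le_trans _ (le _ _))//.
by rewrite scalerA mulVf// scale1r.
Qed.

Let ell1_norm_eq0 (x : ell1) : ell1_norm x = 0 -> x = 0.
Proof.
move=> x0; apply/val_inj/funext => i; apply/eqP.
by rewrite -normr_le0 -x0; exact: (le_sum_norm i (@ell1_summable x)).
Qed.

HB.instance Definition _ := Lmodule_isNormed.Build K ell1
  ell1_normD ell1_normZ ell1_norm_eq0.

End ell1.

Section ellinf.
Variables (R : realType) (k : scalar_kind).
Local Notation K := (scalars R k).
Variable E : normedModType K.

Definition is_ellinf : {pred nat -> E} := [pred x | `[< bounded_fun x >]].

Record ellinf :=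
  Ellinf { ellinf_val :> nat -> E; ellinfP : ellinf_val \in is_ellinf }.

HB.instance Definition _ := [isSub for ellinf_val].
HB.instance Definition _ := [Choice of ellinf by <:].

Let bounded_seqP (x : nat -> E) :
  bounded_fun x <-> exists M : K, forall n, [set: nat] n -> `|x n| <= M.
Proof.
split=> [[M [_ /(_ (M + 1))]]|[M xM]].
  by rewrite ltrDl ltr01 => /(_ isT) xM; exists (M + 1) => n _; exact: xM.
exists M; split; last by move=> N MN n _ /=; rewrite (le_trans (xM n I))// ltW.
by rewrite ger0_real// (le_trans _ (xM 0%N I)).
Qed.

Lemma is_ellinf_submod_closed : submod_closed is_ellinf.
Proof.
split.
  by apply/asboolP/bounded_seqP; exists 0 => n _; rewrite normr0.
move=> a x y /asboolP/bounded_seqP[M xM] /asboolP/bounded_seqP[N yN].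
apply/asboolP/bounded_seqP; exists (`|a| * M + N) => n _.
rewrite (le_trans (ler_normD _ _))// lerD ?yN//.
by rewrite normrZ ler_wpM2l// xM.
Qed.

HB.instance Definition _ :=
  GRing.isSubmodClosed.Build K (nat -> E) is_ellinf is_ellinf_submod_closed.
HB.instance Definition _ := [SubChoice_isSubLmodule of ellinf by <:].

Definition ellinf_norm (x : ellinf) : K := supnorm [set: nat] x.

Let ellinf_bounded (x : ellinf) :
  exists M : K, forall n, [set: nat] n -> `|x n| <= M.
Proof. by have /asboolP/bounded_seqP := ellinfP x. Qed.

Let ellinf_normD (x y : ellinf) :
  ellinf_norm (x + y) <= ellinf_norm x + ellinf_norm y.
Proof.
by have [M xM] := ellinf_bounded x; have [N yN] := ellinf_bounded y;
  exact: supnormD xM yN.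
Qed.

Let ellinf_normZ (a : K) (x : ellinf) :
  ellinf_norm (a *: x) = `|a| * ellinf_norm x.
Proof. by have [M xM] := ellinf_bounded x; exact: supnormZ xM. Qed.

Let ellinf_norm_eq0 (x : ellinf) : ellinf_norm x = 0 -> x = 0.
Proof.
move=> x0; apply/val_inj/funext => i; apply/eqP.
have [M xM] := ellinf_bounded x.
by rewrite -normr_le0 -x0; exact: le_supnorm xM _.
Qed.

HB.instance Definition _ := Lmodule_isNormed.Build K ellinf
  ellinf_normD ellinf_normZ ellinf_norm_eq0.

Lemma ellinf_le_norm (x : ellinf) n : `|x n| <= `|x|.
Proof. by have [M xM] := ellinf_bounded x; exact: le_supnorm xM _. Qed.

End ellinf.

Section state_space.
Variables (R : realType) (k : scalar_kind).
Local Notation K := (scalars R k).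

Definition state_space (E : normedModType K) (e : E) : set (dual E) :=
  [set f : dual E | `|f| = 1 /\ f e = 1].

(* The supremum of the empty set is 0 here; for an unbounded set the value 0 is
   meaningless, but subsets of a unit sphere are bounded. *)
Definition diam (E : normedModType K) (A : set E) : K :=
  supremum 0 [set `|p.1 - p.2| | p in A `*` A].

Variable X : normedModType K.

Definition ellinf_pairing (f : ellinf (dual X)) (x : ell1 X) : K^o :=
  limn (series (fun i => f i (x i))).

Lemma ellinf_pairing_summable (f : ellinf (dual X)) (x : ell1 X) :
  abs_summable (fun i => f i (x i)).
Proof.
apply: (@abs_summable_bounded _ _ _ _ (`|f| * `|x|)) => n.
have [xS _] := sum_norm_sup (@ell1_summable _ _ _ x).
rewrite (le_trans _ (ler_wpM2l (normr_ge0 f) (xS n)))// mulr_sumr.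
apply: ler_sum => i _; rewrite (le_trans (dual_le_norm _ _))//.
by rewrite ler_wpM2r// ellinf_le_norm.
Qed.

Lemma ellinf_pairing_bound (f : ellinf (dual X)) (x : ell1 X) :
  `|ellinf_pairing f x| <= `|f| * `|x|.
Proof.
rewrite (le_trans (lim_series_le_sum_norm (@ellinf_pairing_summable f x)))//.
have [_ ] := sum_norm_sup (@ellinf_pairing_summable f x); apply=> n.
have [xS _] := sum_norm_sup (@ell1_summable _ _ _ x).
rewrite (le_trans _ (ler_wpM2l (normr_ge0 f) (xS n)))// mulr_sumr.
apply: ler_sum => i _; rewrite (le_trans (dual_le_norm _ _))//.
by rewrite ler_wpM2r// ellinf_le_norm.
Qed.

Lemma ellinf_pairing_linear (f : ellinf (dual X)) : linear (ellinf_pairing f).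
Proof.
move=> a x y; apply: cvg_lim => //.
have cx := abs_summable_cvg (@ellinf_pairing_summable f x).
have cy := abs_summable_cvg (@ellinf_pairing_summable f y).
have -> : series (fun i => f i ((a *: x + y) i)) =
    a \*: series (fun i => f i (x i)) \+ series (fun i => f i (y i)).
  apply/funext => n; rewrite /series/= scaler_sumr -big_split/=.
  by apply: eq_bigr => i _; exact: (@dual_linear _ _ _ (f i) a (x i) (y i)).
by apply: cvgD => //; exact: cvgZl_tmp.
Qed.

Lemma ellinf_pairing_continuous (f : ellinf (dual X)) :
  continuous (ellinf_pairing f).
Proof.
pose g := HB.pack_for {linear ell1 X -> K^o} (ellinf_pairing f)
  (GRing.isLinear.Build K (ell1 X) K^o *:%R _ (ellinf_pairing_linear f)).
apply: (@bounded_linear_continuous _ _ _ g); apply/linear_boundedP.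
near=> r => x; rewrite (le_trans (ellinf_pairing_bound f x))// ler_wpM2r//.
Unshelve. all: by end_near. Qed.

Lemma ellinf_pairing_dual (f : ellinf (dual X)) :
  ellinf_pairing f \in @is_dual R k (ell1 X).
Proof.
by apply/asboolP; split; [exact: ellinf_pairing_linear|
                          exact: ellinf_pairing_continuous].
Qed.

(* The identification of l^oo(X^* ) with the dual of l^1(X): it sends (f_i) to
   (x_i) |-> sum_i f_i(x_i). *)
Definition ellinf_dual (f : ellinf (dual X)) : dual (ell1 X) :=
  Dual (ellinf_pairing_dual f).

(* S_x seen as a subset of l^oo(X^* ) through this identification. *)
Definition ell1_state_space (x : ell1 X) : set (ellinf (dual X)) :=
  ellinf_dual @^-1` state_space x.

End state_space.

(* Main.v *)
(** Let [S_i] be the state space of [x_i / ||x_i||]. Peeling one coordinate off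
    [x] shows that a norm-one [f = (f_i)] satisfies
    [|1 - f_i(x_i)| <= 1 - ||x_i||], which together with
    [|f_i(x_i)| <= ||x_i||] forces [f_i(x_i) = ||x_i||]; hence the state space
    of [x] is the full product of the [S_i], all nonempty by Hahn-Banach.

    If the product is compact, so is each coordinate projection [S_i]. Choosing
    [a_i, b_i] in [S_i] with [diam S_i <= 2 ||a_i - b_i||], the sequences
    [h_n] equal to [a_i] for [i < n] and to [b_i] for [i >= n] have a cluster
    point, which is uniformly close to [b_i] for large [i] and equal to [a_i]
    for all [i]; so [||a_i - b_i||] tends to [0].
    Conversely, an ultrafilter on the product converges coordinatewise, and
    [diam S_i -> 0] makes the convergence uniform in [i].

    For Hahn-Banach, a minimal sublinear functional is linear, and Zorn's lemma
    gives one below any given sublinear functional. *)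

Require Import Defs.
From HB Require Import structures.
From mathcomp Require Import all_boot all_order all_algebra.
From mathcomp Require Import all_classical all_reals all_analysis.
From mathcomp Require Import complex lra.
Import Order.TTheory GRing.Theory Num.Theory.
Import numFieldNormedType.Exports.
Local Open Scope classical_set_scope.
Local Open Scope ring_scope.

Set Implicit Arguments.
Unset Strict Implicit.
Unset Printing Implicit Defensive.

(** * Hahn-Banach *)

Section hahn_banach.
Variables (R : realType) (V : lmodType R).
Implicit Types (p q : V -> R) (G : set (V -> R)).

(** Homogeneity is asked only as an inequality for [t > 0], which infima inherit easily; applying it
    to [t^-1] as well gives equality. *)
Definition sublinear p :=
  (forall x y, p (x + y) <= p x + p y) /\
  (forall (t : R) x, 0 < t -> p (t *: x) <= t * p x).

Lemma sublinearZ p t x : sublinear p -> 0 <= t -> p (t *: x) = t * p x.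
Proof.
move=> [pD pZ]; rewrite le_eqVlt => /predU1P[<-|t0].
  (* At the origin, the factor [2] gives [0 <= p 0] and the factor [2^-1] gives [p 0 <= 0]. *)
  have p2 := pZ 2 0 ltac:(lra); have ph := pZ (2^-1) 0 ltac:(lra).
  rewrite scaler0 in p2; rewrite scaler0 in ph.
  by rewrite scale0r; lra.
apply/eqP; rewrite eq_le pZ//= -ler_pdivlMl//.
by rewrite -{1}[x](scalerK (lt0r_neq0 t0)) pZ ?invr_gt0.
Qed.

Lemma sublinear0 p : sublinear p -> p 0 = 0.
Proof. by move=> /(@sublinearZ p 0 0)/(_ (lexx _)); rewrite scale0r mul0r. Qed.

Lemma sublinearN p x : sublinear p -> - p (- x) <= p x.
Proof.
move=> sp; have [pD _] := sp; have := pD x (- x).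
by rewrite subrr sublinear0//; lra.
Qed.

Definition pointwise_inf G x := inf [set g x | g in G].

Lemma pointwise_inf_le G (m : V -> R) g x :
  (forall h y, G h -> m y <= h y) -> G g -> pointwise_inf G x <= g x.
Proof.
move=> Gm Gg; apply: ge_inf; last by exists g.
by exists (m x) => _ [h Gh <-]; exact: Gm.
Qed.

Lemma le_pointwise_inf G a x : G !=set0 ->
  (forall g, G g -> a <= g x) -> a <= pointwise_inf G x.
Proof.
move=> [g Gg] Ga; apply: lb_le_inf; first by exists (g x), g.
by move=> _ [h Gh <-]; exact: Ga.
Qed.

(** The two domination conditions on [G] fit both a family of shifts along a ray and a chain; the
    minorant [m] makes the real infima meaningful. *)
Lemma sublinear_pointwise_inf G (m : V -> R) : G !=set0 ->
  (forall g x, G g -> m x <= g x) ->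
  (forall g h x y, G g -> G h -> exists2 k, G k & k (x + y) <= g x + h y) ->
  (forall g t x, G g -> 0 < t -> exists2 k, G k & k (t *: x) <= t * g x) ->
  sublinear (pointwise_inf G).
Proof.
move=> G0 Gm GD GZ; split=> [x y|t x t0].
  rewrite -lerBlDr; apply: le_pointwise_inf => // g Gg.
  rewrite lerBlDl -lerBlDr; apply: le_pointwise_inf => // h Gh.
  have [k Gk kE] := GD g h x y Gg Gh.
  by rewrite lerBlDr [leRHS]addrC (le_trans _ kE)// (pointwise_inf_le _ Gm).
rewrite -ler_pdivrMl//; apply: le_pointwise_inf => // g Gg.
have [k Gk kE] := GZ g t x Gg t0.
by rewrite ler_pdivrMl// (le_trans _ kE)// (pointwise_inf_le _ Gm).
Qed.

(* Subtracting the linear growth of [p] along the ray [v] gives a sublinear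
   functional below [p] that is as small as possible at [- v]. *)
Lemma sublinear_descent p v : sublinear p -> exists q,
  [/\ sublinear q, (forall x, q x <= p x) & q (- v) <= - p v].
Proof.
move=> sp; have [pD pZ] := sp.
pose G := [set (fun y => p (y + t *: v) - t * p v) | t in [set t : R | 0 <= t]].
(* Subadditivity at [(x + t *: v) + (- x)] bounds every member below, uniformly in [t]. *)
have Gm g x : G g -> - p (- x) <= g x.
  move=> [t t0 <-] /=; rewrite -sublinearZ//.
  have := pD (x + t *: v) (- x); rewrite addrAC subrr add0r; lra.
exists (pointwise_inf G); split.
- apply: (sublinear_pointwise_inf (m := fun x => - p (- x))) => //.
  + by exists (fun y => p (y + 0 *: v) - 0 * p v), 0 => //=.
  + move=> _ _ x y [s s0 <-] [t t0 <-].
    exists (fun y => p (y + (s + t) *: v) - (s + t) * p v).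
      by exists (s + t) => //=; rewrite addr_ge0.
    by rewrite scalerDl addrACA; have := pD (x + s *: v) (y + t *: v); lra.
  + move=> _ t x [s s0 <-] t0.
    exists (fun y => p (y + (t * s) *: v) - (t * s) * p v).
      by exists (t * s) => //=; rewrite mulr_ge0// ltW.
    by rewrite mulrBr mulrA lerD2r -scalerA -scalerDr pZ.
- move=> x; have -> : p x = p (x + 0 *: v) - 0 * p v.
    by rewrite scale0r addr0 mul0r subr0.
  apply: (@pointwise_inf_le G (fun x => - p (- x))
    (fun y => p (y + 0 *: v) - 0 * p v)) => //.
  by exists 0 => //=.
- have -> : - p v = p (- v + 1 *: v) - 1 * p v.
    by rewrite scale1r addNr sublinear0// sub0r mul1r.
  apply: (@pointwise_inf_le G (fun x => - p (- x))
    (fun y => p (y + 1 *: v) - 1 * p v)) => //.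
  by exists 1 => //=.
Qed.

Lemma minimal_sublinear p : sublinear p -> exists q,
  [/\ sublinear q, (forall x, q x <= p x) &
      forall r, sublinear r -> (forall x, r x <= q x) -> forall x, q x <= r x].
Proof.
move=> sp; pose T := {q | sublinear q /\ forall x, q x <= p x}.
(* The order is reversed, so that a maximal element in Zorn's lemma is a minimal functional. *)
pose below (q r : T) := `[< forall x, sval r x <= sval q x >].
pose tp : T := exist _ p (conj sp (fun=> lexx _)).
have [||A Atot|[q [sq qp]] qmin] := @ZL_preorder T tp below.
- by move=> t; apply/asboolP.
- move=> q r s /asboolP rq /asboolP sr; apply/asboolP => x.
  exact: le_trans (sr x) (rq x).
(* The infimum over an empty chain says nothing, so [p] itself bounds that chain. *)
- have [[q0 Aq0]|A0] := pselect (A !=set0); last first.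
    by exists tp => q Aq; case: A0; exists q.
  pose G := [set sval q | q in A].
  have Gm g x : G g -> - p (- x) <= g x.
    move=> [[{}g [sg gp]] Ag <-] /=.
    by rewrite (le_trans _ (sublinearN x sg))// lerN2.
  have sG : sublinear (pointwise_inf G).
    apply: (sublinear_pointwise_inf (m := fun x => - p (- x))) => //.
    + by exists (sval q0), q0.
    + move=> _ _ x y [g Ag <-] [h Ah <-].
      have [/asboolP gh|/asboolP gh] := Atot _ _ Ag Ah.
      * exists (sval h); first by exists h.
        have [[+ _] _] := svalP h; move=> /(_ x y)/le_trans; apply.
        by rewrite lerD2r.
      * exists (sval g); first by exists g.
        have [[+ _] _] := svalP g; move=> /(_ x y)/le_trans; apply.
        by rewrite lerD2l.
    + move=> _ t x [g Ag <-] t0; exists (sval g); first by exists g.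
      by have [[_ +] _] := svalP g; apply.
  have Gp x : pointwise_inf G x <= p x.
    have [_ q0p] := svalP q0.
    by rewrite (le_trans _ (q0p x))// (pointwise_inf_le _ Gm)//; exists q0.
  exists (exist _ (pointwise_inf G) (conj sG Gp)) => s As; apply/asboolP => x /=.
  by rewrite (pointwise_inf_le _ Gm)//; exists s.
exists q; split=> // r sr rq.
have rp x : r x <= p x by exact: le_trans (rq x) (qp x).
have := qmin (exist _ r (conj sr rp)); rewrite /below /=.
by move=> /(_ (introT (asboolP _) rq))/asboolP.
Qed.

(** Descent along [x] cannot go strictly below a minimal [q], which forces [q (- x) = - q x]; an odd
    subadditive functional is additive. *)
Lemma minimal_sublinear_linear q : sublinear q ->
  (forall r, sublinear r -> (forall x, r x <= q x) -> forall x, q x <= r x) ->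
  linear (q : V -> R^o).
Proof.
move=> sq qmin; have [qD _] := sq.
have qN x : q (- x) = - q x.
  have [r [sr rq rx]] := sublinear_descent x sq.
  apply/eqP; rewrite eq_le (le_trans (qmin _ sr rq _) rx)/=.
  by have := sublinearN x sq; lra.
have qadd x y : q (x + y) = q x + q y.
  apply/eqP; rewrite eq_le qD/=.
  by have := qD (x + y) (- y); rewrite addrK qN; lra.
move=> a x y; rewrite qadd; congr (_ + _).
have [a0|a0] := leP 0 a; first exact: sublinearZ.
rewrite -[a *: x]opprK -scaleNr qN sublinearZ//; last by rewrite oppr_ge0 ltW.
by rewrite mulNr opprK.
Qed.

Lemma hahn_banach_sublinear p u : sublinear p ->
  exists f : V -> R^o, [/\ linear f, (forall x, f x <= p x) & f u = p u].
Proof.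
(* Descending along [u] before minimizing gives [q (- u) <= - p u], which pins the value at [u]. *)
move=> sp; have [p' [sp' p'p p'u]] := sublinear_descent u sp.
have [q [sq qp' qmin]] := minimal_sublinear sp'.
exists q; split; first exact: minimal_sublinear_linear.
  by move=> x; exact: le_trans (qp' x) (p'p x).
apply/eqP; rewrite eq_le (le_trans (qp' u))//=.
by have := sublinearN u sq; have := qp' (- u); lra.
Qed.

End hahn_banach.

(** * Complex spaces as real spaces *)

Section realification.
Variables (R : realType) (V : lmodType R[i]).

Definition realification : Type := V.

HB.instance Definition _ := GRing.Zmodule.copy realification V.

Let scale (a : R) (x : realification) : realification :=
  ((a%:C)%C : R[i]) *: (x : V).

Let scaleA a b x : scale a (scale b x) = scale (a * b) x.
Proof. by rewrite /scale scalerA -rmorphM. Qed.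

Let scale1 : left_id 1 scale.
Proof. by move=> x; rewrite /scale scale1r. Qed.

Let scaleDr : right_distributive scale +%R.
Proof. by move=> a x y; rewrite /scale scalerDr. Qed.

Let scaleDl x : {morph scale^~ x : a b / a + b}.
Proof. by move=> a b; rewrite /scale rmorphD scalerDl. Qed.

HB.instance Definition _ := GRing.Zmodule_isLmodule.Build R realification
  scaleA scale1 scaleDr scaleDl.

Lemma realification_scaleE (a : R) (x : V) :
  a *: (x : realification) = ((a%:C)%C : R[i]) *: x.
Proof. by []. Qed.

End realification.

(** * Existence of states *)

Section states.
Variables (R : realType) (k : scalar_kind).
Local Notation K := (scalars R k).

Lemma dual_norm_le (E : normedModType K) (f : dual E) (M : K) : 0 <= M ->
  (forall x, `|f x| <= M * `|x|) -> `|f| <= M.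
Proof.
move=> M0 fM; apply: supnorm_le => // x x1.
by rewrite (le_trans (fM x))// -[leRHS]mulr1 ler_wpM2l.
Qed.

(** At a unit vector, [f e = 1] already forces the norm of [f] to be at least 1. *)
Lemma state_spaceP (E : normedModType K) (e : E) (f : dual E) : `|e| = 1 ->
  state_space e f <-> `|f| <= 1 /\ f e = 1.
Proof.
move=> e1; split=> [[-> ->]//|[f1 fe]]; split=> //.
apply/eqP; rewrite eq_le f1/=.
by have := dual_le_norm f e; rewrite fe e1 normr1 mulr1.
Qed.

Lemma state_of_contraction (E : normedModType K) (e : E) (f : E -> K^o) :
  linear f -> (forall x, `|f x| <= `|x|) -> `|e| = 1 -> f e = 1 ->
  state_space e !=set0.
Proof.
move=> fl f1 e1 fe.
pose g := HB.pack_for {linear E -> K^o} f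
  (GRing.isLinear.Build K E K^o *:%R _ fl).
have fc : continuous f.
  apply: (@bounded_linear_continuous _ _ _ g); apply/linear_boundedP.
  by near=> r => x; rewrite (le_trans (f1 x))// ler_peMl.
have fd : f \in @is_dual R k E by apply/asboolP.
exists (Dual fd); apply/state_spaceP => //; split=> //.
by apply: dual_norm_le => // x; rewrite mul1r; exact: f1.
Unshelve. all: by end_near. Qed.

End states.

Lemma real_state_space_nonempty (R : realType)
    (E : normedModType (scalars R RealScalars)) (e : E) :
  `|e| = 1 -> state_space e !=set0.
Proof.
move=> e1.
have sn : sublinear (fun x : E => `|x| : R).
  split=> [x y|t x t0]; first exact: ler_normD.
  by rewrite normrZ gtr0_norm.
have [f [fl fn fe]] := @hahn_banach_sublinear R E _ e sn.
apply: (@state_of_contraction R RealScalars E e f) => //; last by rewrite fe e1.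
pose g := HB.pack_for {linear E -> R^o} f
  (GRing.isLinear.Build R E R^o *:%R _ fl).
have fN x : f (- x) = - f x by exact: (linearN g).
move=> x; rewrite (@ler_norml R) fn andbT -lerN2 opprK -fN.
by rewrite (le_trans (fn _))// normrN.
Qed.

Lemma normcRe (R : realType) (V : normedModType R[i]) (x : V) :
  `|x| = ((complex.Re `|x|)%:C)%C.
Proof. by apply/esym/RRe_real/ger0_real. Qed.

(** Squaring gives Re(z)^2 + Im(z)^2 <= Re(z)^2, so the imaginary part vanishes. *)
Lemma normc_le_Re (R : realType) (z : R[i]) :
  `|z| <= ((complex.Re z)%:C)%C -> z = ((complex.Re z)%:C)%C.
Proof.
move=> zle; have zge0 : 0 <= complex.Re z.
  by rewrite -lecR; exact: le_trans (normr_ge0 z) zle.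
have : `|z| ^+ 2 <= ((complex.Re z)%:C)%C ^+ 2.
  by rewrite lerXn2r// ?nnegrE// lecR.
rewrite -add_Re2_Im2 -rmorphXn/= lecR gerDl => z2.
have /eqP : complex.Im z ^+ 2 = 0 by apply/eqP; rewrite eq_le z2 sqr_ge0.
by rewrite sqrf_eq0; case: z {zle zge0 z2} => a b /= /eqP ->.
Qed.

Lemma scale_complexE (R : rcfType) (V : lmodType R[i]) (a : R[i]) (x : V) :
  a *: x = (complex.Re a)%:C%C *: x + (complex.Im a)%:C%C *: ('i%C *: x).
Proof.
by rewrite scalerA -scalerDl [_ * 'i%C]mulrC -complexE.
Qed.

Lemma mulCE (R : rcfType) (a b c d : R) :
  ((a +i* b) * (c +i* d))%C = ((a * c - b * d) +i* (a * d + b * c))%C.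
Proof. by []. Qed.

Lemma mulCiE (R : rcfType) (a b : R) : ('i * (a +i* b))%C = ((- b) +i* a)%C.
Proof. by rewrite mulCE !mul0r !mul1r sub0r add0r. Qed.

(** Real Hahn-Banach on the realification supplies the real part [q], and complex linearity dictates
    the imaginary part. *)
Lemma hahn_banach_complex (R : realType) (E : normedModType R[i]) (e : E) :
  exists f : E -> R[i]^o,
    [/\ linear f, (forall x, `|f x| <= `|x|) & f e = `|e|].
Proof.
pose N (x : realification E) : R := complex.Re `|x : E|.
have NE (x : E) : `|x| = ((N x)%:C)%C by exact: normcRe.
have sn : sublinear N.
  split=> [x y|t x t0].
    by have := ler_normD (x : E) y; rewrite !NE -rmorphD lecR.
  rewrite /N realification_scaleE normrZ ger0_norm; last by rewrite lecR ltW.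
  by rewrite NE -rmorphM.
have [q [ql qN qe]] := @hahn_banach_sublinear R (realification E) N e sn.
pose g := HB.pack_for {linear realification E -> R^o} q
  (GRing.isLinear.Build R _ R^o *:%R _ ql).
have qD (x y : E) : q (x + y) = q x + q y by exact: (linearD g).
have qZ a (x : E) : q (a%:C%C *: x) = a * q x by exact: (linearZ_LR g a x).
(* The complex-linear functional with real part [q]. *)
pose f (x : E) : R[i]^o := (q x +i* - q ('i%C *: x))%C.
have fD x y : f (x + y) = f x + f y.
  by rewrite /f scalerDr !qD opprD.
have qC (a : R[i]) (x : E) :
    q (a *: x) = complex.Re a * q x + complex.Im a * q ('i%C *: x).
  by rewrite scale_complexE qD !qZ.
have fZ (a : R[i]) x : f (a *: x) = a * f x.
  rewrite /f scalerA (qC a) (qC ('i%C * a)); case: a => r s.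
  rewrite mulCiE mulCE; congr (_ +i* _)%C;
    by rewrite /complex.Re /complex.Im; lra.
have fn x : `|f x| <= `|x|.
  have [->|f0] := eqVneq (f x) 0; first by rewrite normr0.
  (* Rotation trick: at [x] scaled by the conjugate of [f x], the value of [f] is the square of the
     modulus of [f x]. It is real, hence equal to the value of [q], which the norm dominates. *)
  rewrite -(ler_pM2l (_ : 0 < `|f x|)) ?normr_gt0//.
  have fE : f (((f x)^*)%C *: x) = `|f x| ^+ 2 by rewrite fZ mulrC sqr_normc.
  have := qN (((f x)^*)%C *: x); rewrite -lecR -NE normrZ normcJ -expr2.
  apply: le_trans.
  have -> : q ((f x)^*%C *: x) = complex.Re (`|f x| ^+ 2) by rewrite -fE.
  by rewrite RRe_real// realX// normr_real.
exists f; split=> //; first by move=> a x y; rewrite fD fZ.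
have fe : complex.Re (f e) = N e by rewrite -qe.
by rewrite NE -fe; apply: normc_le_Re; rewrite fe -NE.
Qed.

Lemma complex_state_space_nonempty (R : realType)
    (E : normedModType (scalars R ComplexScalars)) (e : E) :
  `|e| = 1 -> state_space e !=set0.
Proof.
move=> e1; have [f [fl fn fe]] := @hahn_banach_complex R E e.
by apply: (@state_of_contraction R ComplexScalars E e f) => //; rewrite fe e1.
Qed.

Lemma state_space_nonempty (R : realType) (k : scalar_kind)
    (E : normedModType (scalars R k)) (e : E) :
  `|e| = 1 -> state_space e !=set0.
Proof.
case: k E e => E e; first exact: real_state_space_nonempty.
exact: complex_state_space_nonempty.
Qed.

(** * States of a norm-one sequence *)

(** Since Re(1 - z) <= |1 - z| <= 1 - a, one gets a <= Re(z) <= |z| <= a, so [z] is real and equal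
    to [a]. *)
Lemma norm_split_eq_complex (R : realType) (z a : R[i]) :
  `|z| <= a -> `|1 - z| <= 1 - a -> z = a.
Proof.
move=> za z1a.
have aRe : a <= ((complex.Re z)%:C)%C.
  rewrite -lerN2 -(lerD2l 1); apply: le_trans z1a.
  have -> : 1 - ((complex.Re z)%:C)%C = ((complex.Re (1 - z))%:C)%C.
    by case: z za => u v _; rewrite -[complex.Re (1 - _)]/(1 - u) rmorphB.
  by apply: le_trans (normc_ge_Re _); rewrite lecR ler_norm.
have zE := normc_le_Re (le_trans za aRe).
apply/le_anti; rewrite [X in _ && (_ <= X)]zE aRe andbT (le_trans _ za)//.
by rewrite zE normc_def/= expr0n addr0 sqrtr_sqr lecR ler_norm.
Qed.

Lemma norm_split_eq (R : realType) (k : scalar_kind) (z a : scalars R k) :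
  `|z| <= a -> `|1 - z| <= 1 - a -> z = a.
Proof.
case: k z a => z a; last exact: norm_split_eq_complex.
rewrite !(@ler_norml R) => /andP[_ za] /andP[_ z1a].
by apply: (@le_anti _ R); rewrite za/= -lerN2 -(lerD2l 1).
Qed.

Section ell1_single.
Variables (R : realType) (k : scalar_kind) (E : normedModType (scalars R k)).
Local Notation K := (scalars R k).
Implicit Types (x : ell1 E) (y : E) (j : nat).

Let single_seq j y : nat -> E := fun i => if i == j then y else 0.

Let single_seq_sum j y n : \sum_(i < n) `|single_seq j y i| <= `|y|.
Proof.
have [jn|jn] := ltnP j n.
  rewrite (bigD1 (Ordinal jn))//= /single_seq eqxx big1 ?addr0// => i.
  by rewrite -val_eqE/= => /negPf ->; rewrite normr0.
rewrite big1// => i _; rewrite /single_seq ifF ?normr0//.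
by apply/negbTE; rewrite neq_ltn (leq_trans (ltn_ord i) jn).
Qed.

Let single_ell1 j y : single_seq j y \in @is_ell1 R k E.
Proof. by apply/asboolP; exact: abs_summable_bounded (single_seq_sum j y). Qed.

Definition ell1_single j y : ell1 E := Ell1 (single_ell1 j y).

Lemma ell1_singleE j y i : ell1_single j y i = if i == j then y else 0.
Proof. by []. Qed.

Lemma ell1_norm_le x (M : K) :
  (forall n, \sum_(i < n) `|x i| <= M) -> `|x| <= M.
Proof. by have [_] := sum_norm_sup (@ell1_summable _ _ _ x); apply. Qed.

Lemma le_ell1_norm x n : \sum_(i < n) `|x i| <= `|x|.
Proof. by have [+ _] := sum_norm_sup (@ell1_summable _ _ _ x); apply. Qed.

Lemma ell1_single_norm j y : `|ell1_single j y| <= `|y|.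
Proof. by apply: ell1_norm_le => n; exact: single_seq_sum. Qed.

Lemma ell1_subr_single_norm x j : `|x - ell1_single j (x j)| <= `|x| - `|x j|.
Proof.
apply: ell1_norm_le => n.
have -> : \sum_(i < n) `|(x - ell1_single j (x j)) i| =
    \sum_(i < n | i != j :> nat) `|x i|.
  rewrite [RHS]big_mkcond/=; apply: eq_bigr => i _.
  rewrite -[LHS]/(`|x i - ell1_single j (x j) i|) ell1_singleE.
  by have [->|_] := eqVneq (i : nat) j; rewrite ?subrr ?normr0 ?subr0.
(* A partial sum of length [m] contains both the first [n] terms and the term of index [j]. *)
rewrite lerBrDl; pose m := maxn n j.+1.
have jm : (j < m)%N by rewrite leq_max leqnn orbT.
apply: le_trans (le_ell1_norm x m).
rewrite (bigD1 (Ordinal jm))//= lerD2l.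
rewrite -(big_mkord (fun i => i != j) (fun i => `|x i|)).
rewrite -(big_mkord (fun i => i != j) (fun i => `|x i|)).
by rewrite [leRHS](big_cat_nat (n := n)) ?leq_maxl//= lerDl sumr_ge0.
Qed.

Lemma ellinf_pairing_single (f : ellinf (dual E)) j y :
  ellinf_pairing f (ell1_single j y) = f j y.
Proof.
apply: lim_near_cst; first exact: norm_hausdorff.
exists j.+1 => // n /= jn.
rewrite /series/= big_mkord (bigD1 (Ordinal jn))//= /single_seq eqxx.
rewrite big1 ?addr0// => i; rewrite -val_eqE/= => /negPf ij.
by rewrite ij linear0.
Qed.

End ell1_single.

(** * The state space as a product *)

Section ell1_states.
Variables (R : realType) (k : scalar_kind) (X : normedModType (scalars R k)).
Local Notation K := (scalars R k).
Variable x : ell1 X.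
Hypotheses (x_norm1 : `|x| = 1) (x_neq0 : forall i, `|x i| != 0).

Lemma norm_normalized i : `| `|x i|^-1 *: x i | = 1.
Proof. by rewrite normrZ normfV normr_id mulVf. Qed.

Lemma normalized_eq1 (f : dual X) i :
  f (`|x i|^-1 *: x i) = 1 <-> f (x i) = `|x i|.
Proof.
have -> : f (`|x i|^-1 *: x i) = `|x i|^-1 * f (x i) by exact: linearZ_LR.
split=> [fx|->]; last exact: mulVf.
by rewrite -[LHS](mulVKf (x_neq0 i)) fx mulr1.
Qed.

Lemma ell1_state_spaceP (f : ellinf (dual X)) : ell1_state_space x f <->
  forall i, state_space (`|x i|^-1 *: x i) (f i).
Proof.
split=> [[f1 fx] i|fS].
  have fle y : `|ellinf_pairing f y| <= `|y|.
    by rewrite (le_trans (dual_le_norm (ellinf_dual f) y))// f1 mul1r.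
  have fi y : `|f i y| <= `|y|.
    by rewrite -ellinf_pairing_single (le_trans (fle _))// ell1_single_norm.
  apply/state_spaceP; first exact: norm_normalized.
  split; first by apply: dual_norm_le => // y; rewrite mul1r.
  apply/normalized_eq1/norm_split_eq => //.
  (* Removing the entry of index [i] leaves a vector of norm at most 1 - |x_i|, and [f] is a
     contraction. *)
  have -> : 1 - f i (x i) = ellinf_dual f (x - ell1_single i (x i)).
    apply/esym/(etrans (linearB (ellinf_dual f) _ _)); congr (_ - _) => //.
    exact: ellinf_pairing_single.
  by rewrite (le_trans (fle _))// -x_norm1 ell1_subr_single_norm.
have f1 : `|f| <= 1.
  by apply: supnorm_le => // i _; have [-> _] := fS i.
apply/state_spaceP => //; split.
  apply: dual_norm_le => // y; rewrite mul1r.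
  by rewrite (le_trans (ellinf_pairing_bound f y))// ler_piMl.
rewrite -[RHS]x_norm1.
(* Termwise f_i(x_i) = |x_i|, and the limit of the series of norms is the norm of [x] by
   definition. *)
have -> : ellinf_dual f x = limn (series (fun i => `|x i| : K^o)).
  congr (limn (series _)); apply/funext => i.
  by have [_ /normalized_eq1] := fS i.
by [].
Qed.

End ell1_states.

(** * Compact products of bounded sets *)

Section diam.
Variables (R : realType) (k : scalar_kind) (E : normedModType (scalars R k)).
Local Notation K := (scalars R k).
Variable A : set E.

Lemma le_diam (M : K) a b : (forall a b, A a -> A b -> `|a - b| <= M) ->
  A a -> A b -> `|a - b| <= diam A.
Proof.
move=> A_bounded Aa Ab.
apply: (@le_supnorm R k _ E (A `*` A) (fun p => p.1 - p.2) M (a, b)) => //.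
by move=> [c d] [/= Ac Ad]; exact: A_bounded.
Qed.

Lemma diam_ge0 : 0 <= diam A. Proof. exact: supnorm_ge0. Qed.

Lemma diam_le (N : K) : 0 <= N -> (forall a b, A a -> A b -> `|a - b| <= N) ->
  diam A <= N.
Proof.
by move=> N0 AN; apply: supnorm_le => // -[a b] [/= Aa Ab]; exact: AN.
Qed.

(** The factor 2 gives slack, as the supremum may not be attained: if every pair failed, [diam A]
    would be at most half of itself, hence 0, whereas failure at [(a0, a0)] makes it positive. *)
Lemma diam_half_attained : A !=set0 ->
  exists a b, [/\ A a, A b & diam A <= 2 * `|a - b|].
Proof.
move=> [a0 Aa0]; apply: contrapT => nab.
have lt2 a b : A a -> A b -> 2 * `|a - b| < diam A.
  move=> Aa Ab; rewrite real_ltNge ?realM ?ger0_real ?diam_ge0//.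
  by apply/negP => abd; apply: nab; exists a, b.
have : 0 < diam A by rewrite (le_lt_trans _ (lt2 _ _ Aa0 Aa0))// mulr_ge0.
apply/negP; rewrite lt_neqAle diam_ge0 andbT negbK.
have : diam A <= diam A / 2.
  apply: diam_le => [|a b Aa Ab]; first by rewrite divr_ge0// diam_ge0.
  by rewrite ler_pdivlMr// mulrC ltW// lt2.
rewrite {1}(splitr (diam A)) gerDl => d0.
rewrite eq_sym eq_le diam_ge0 andbT.
by rewrite -(ler_pM2r (_ : 0 < 2^-1)) ?mul0r ?invr_gt0.
Qed.

End diam.

Lemma ellinf_of_bounded (R : realType) (k : scalar_kind)
    (E : normedModType (scalars R k)) (u : nat -> E) (M : scalars R k) :
  (forall i, `|u i| <= M) -> exists x : ellinf E, x = u :> (nat -> E).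
Proof.
move=> uM; have ub : u \in @is_ellinf R k E; last by exists (Ellinf ub).
apply/asboolP; exists M; split.
  by rewrite ger0_real// (le_trans _ (uM 0%N)).
by move=> N MN n _ /=; rewrite (le_trans (uM n))// ltW.
Qed.

Lemma ellinf_proj_continuous (R : realType) (k : scalar_kind)
    (E : normedModType (scalars R k)) (i : nat) :
  continuous (fun x : ellinf E => x i).
Proof.
move=> x; apply/(@cvgrPdist_le _ _ _ (nbhs x)) => e e0.
near=> y; apply: le_trans (ellinf_le_norm (x - y) i) _.
by near: y; apply: cvgr_dist_le.
Unshelve. all: by end_near. Qed.

Section compactness.
Variables (R : realType) (k : scalar_kind) (E : normedModType (scalars R k)).
Local Notation K := (scalars R k).
Variable A : nat -> set E.

(** The topology is that of the supremum norm, not the product topology, so Tychonoff's theorem does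
    not settle compactness. *)
Definition ellinf_prod : set (ellinf E) := [set x | forall i, A i (x i)].

Hypothesis A_nonempty : forall i, A i !=set0.
Variable M : K.
Hypothesis A_bounded : forall i a, A i a -> `|a| <= M.

Let A_diff i a b : A i a -> A i b -> `|a - b| <= M + M.
Proof.
move=> Aa Ab; rewrite (le_trans (ler_normB _ _))//.
by rewrite lerD// (A_bounded (i := i)).
Qed.

Let prod_of u : (forall i, A i (u i)) ->
  exists2 x : ellinf E, ellinf_prod x & x = u :> (nat -> E).
Proof.
move=> Au; have [x xu] := ellinf_of_bounded (fun i => A_bounded (Au i)).
by exists x => // i; rewrite xu.
Qed.

Lemma compact_ellinf_prod_factor i : compact ellinf_prod -> compact (A i).
Proof.
move=> cA; have -> : A i = (fun x : ellinf E => x i) @` ellinf_prod.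
  apply/seteqP; split=> [a Aa|_ [x Ax <-]//].
  have [u Au] := choice A_nonempty.
  (* Any point of [A i] extends to the product by filling the other coordinates with chosen
     points. *)
  have [j|x Ax xE] := @prod_of (fun j => if j == i then a else u j).
    by have [->|] := eqVneq j i.
  by exists x => //; rewrite xE eqxx.
apply: continuous_compact => //; apply: continuous_subspaceT.
exact: ellinf_proj_continuous.
Qed.

Lemma compact_ellinf_prod_diam : compact ellinf_prod ->
  (fun i => diam (A i)) @ \oo --> (0 : K).
Proof.
move=> cA.
have /choice[ab abP] i : exists ab : E * E,
    [/\ A i ab.1, A i ab.2 & diam (A i) <= 2 * `|ab.1 - ab.2|].
  have [a [b abi]] := diam_half_attained (A_nonempty i).
  by exists (a, b).
have /choice[h hP] n : exists x : ellinf E, ellinf_prod x /\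
    x = (fun i => if (i < n)%N then (ab i).1 else (ab i).2) :> (nat -> E).
  have [i|x Ax xE] :=
    @prod_of (fun i => if (i < n)%N then (ab i).1 else (ab i).2).
    by have [? ? _] := abP i; case: ifP.
  by exists x.
have [|c [Ac hc]] := cA (h @ \oo).
  by exists 0%N => // n _; have [] := hP n.
(* A cluster point of [h] is approached by [h n] for arbitrarily large [n]. *)
have hnear N e : 0 < e -> exists2 n, (N <= n)%N & `|c - h n| < e.
  move=> e0; have [||_ [[n Nn <-] cn]] :=
    hc (h @` [set n | (N <= n)%N]) (ball c e).
  - by exists N => // n Nn; exists n.
  - exact: nbhsx_ballx.
  by exists n => //; move: cn; rewrite -ball_normE.
(* Two distances below [e / 2 / 2] bound the distance of the pair by [e / 2]; the factor 2 in the
   choice of the pair then gives [e]. *)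
apply/cvgrPdist_lt => e e0; have e40 : 0 < e / 2 / 2 by rewrite !divr_gt0.
have [n _ cn] := hnear 0%N _ e40; exists n => // i /= ni.
(* The index [n] is fixed and [n <= i], so [h n] shows the second point at [i]; [m] depends on [i]
   and exceeds it, so [h m] shows the first. *)
have [m im cm] := hnear i.+1 _ e40.
have cin : `|c i - (ab i).2| < e / 2 / 2.
  apply: le_lt_trans cn; have := ellinf_le_norm (c - h n) i.
  by rewrite -[(c - h n) i]/(c i - h n i) (hP n).2 ltnNge ni.
have cim : `|c i - (ab i).1| < e / 2 / 2.
  apply: le_lt_trans cm; have := ellinf_le_norm (c - h m) i.
  by rewrite -[(c - h m) i]/(c i - h m i) (hP m).2 im.
rewrite sub0r normrN ger0_norm ?diam_ge0//.
have [_ _ /le_lt_trans] := abP i; apply.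
rewrite mulrC -ltr_pdivlMr// [ltRHS]splitr.
by rewrite (le_lt_trans (ler_distD (c i) _ _))// ltrD// distrC.
Qed.

Lemma ellinf_prod_compact : (forall i, compact (A i)) ->
  (fun i => diam (A i)) @ \oo --> (0 : K) -> compact ellinf_prod.
Proof.
move=> cA dA; rewrite compact_ultra => F FU FA.
have /choice[u uP] i : exists a : E, A i a /\
    (fun x : ellinf E => x i) @ F --> a.
  have [|a [Aa clu]] := cA i ((fun x : ellinf E => x i) @ F).
    suff FAi : F [set x : ellinf E | A i (x i)] by exact: FAi.
    by apply: filterS FA => x Ax; exact: Ax.
  exists a; split=> // V Va.
  (* A cluster point of an ultrafilter is a limit: otherwise the complement of a neighbourhood [V]
     would belong to the filter and would have to meet [V]. *)
  have [//|FnV] := in_ultra_setVsetC ((fun x : ellinf E => x i) @^-1` V) FU.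
  by have [b [/= nVb Vb]] := clu (~` V) V FnV Va.
have [i|c Ac cE] := prod_of (u := u); first by have [] := uP i.
exists c; split=> //; apply: (@cvgrPdist_le _ _ _ F _ id c).2 => e e0.
have [N _ dN] := (cvgrPdist_le _ _).1 dA e e0.
(* Coordinates below [N] are finitely many, so their convergence can be intersected; from [N] on,
   the diameter alone bounds the distance. *)
have smalli (i : 'I_N) : \forall x \near F, `|c i - (x : ellinf E) i| <= e.
  by rewrite cE; apply: (cvgrPdist_le _ _).1 => //; have [] := uP i.
have FF : Filter F by exact: filter_filter.
have small := filter_forall FF smalli.
suff Fe : F [set x : ellinf E | `|c - x| <= e] by exact: Fe.
apply: filterS2 FA small => x Ax xs.
apply: supnorm_le => [|i _]; first exact: ltW.
rewrite -[X in `|X| <= _]/(c i - (x : ellinf E) i).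
have [iN|Ni] := ltnP i N; first exact: (xs (Ordinal iN)).
apply: le_trans (le_diam (@A_diff i) (Ac i) (Ax i)) _.
by have := dN i Ni; rewrite /= sub0r normrN ger0_norm ?diam_ge0.
Qed.

End compactness.

Theorem proposition3p16 (R : realType) (k : scalar_kind)
    (X : completeNormedModType (scalars R k)) (x : ell1 X)
    (x_norm1 : `|x| = 1) (x_neq0 : forall i : nat, `|x i| != 0) :
  compact (ell1_state_space x) <->
  (forall i : nat, compact (state_space (`|x i|^-1 *: x i))) /\
  ((fun i : nat => diam (state_space (`|x i|^-1 *: x i))) @ \oo -->
     (0 : scalars R k)).
Proof.
pose S i := state_space (`|x i|^-1 *: x i).
have -> : ell1_state_space x = ellinf_prod S.
  by apply/seteqP; split=> f /ell1_state_spaceP; apply.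
have S0 i : S i !=set0 by apply: state_space_nonempty; exact: norm_normalized.
have S1 i f : S i f -> `|f| <= 1 by case=> ->.
split=> [cS|[cS dS]]; last exact: ellinf_prod_compact S1 cS dS.
split=> [i|]; first exact: (compact_ellinf_prod_factor S0 S1 cS).
exact: (compact_ellinf_prod_diam S0 S1 cS).
Qed.
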